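(* Let $q\ge2$ and let $\phi:\mathbb{R}\to\mathbb{R}$ be a 1-Lipschitz, 1-positive-homogeneous activation. Let $(x_i,y_i)_{i=1}^n$ with $x_i\in\mathbb{R}^d$, $y_i\in\{-1,+1\}$ be training data. Let $\mathcal{M}=(m_1,\dots,m_{q-1})$ and $\mathcal{M}'=(m_1',\dots,m_{q-1}')$ be two sequences of hidden layer sizes with $m_i\le m_i'$ for all $i=1,\dots,q-1$. Then $$\gamma^{\star,\mathcal{M}}\le\gamma^{\star,\mathcal{M}'} .$$ Consequently (when $\gamma^{\star,\mathcal{M}}>0$) the generalization bound $$\frac{C}{\gamma\,q^{(q-1)/2}\sqrt n}+\sqrt{\frac{\log\log_2\frac{4C}{\gamma}}{n}}+\sqrt{\frac{\log(1/\delta)}{n}}$$ evaluated at $\gamma=\gamma^{\star,\mathcal{M}'}$ is at most its value at $\gamma=\gamma^{\star,\mathcal{M}}$, where $C=\sup_{x\in\mathcal X}\|x\|_2$ is the largest norm of a datapoint in the data domain $\mathcal X$ and $\delta\in(0,1)$.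
   Context: $\phi$ is 1-positive-homogeneous if $\phi(ct)=c\phi(t)$ for $c>0$. The depth-$q$ network with architecture $\mathcal{M}=(m_1,\dots,m_{q-1})$ has parameters $\Theta=(W_1,\dots,W_q)$, $W_1\in\mathbb{R}^{m_1\times d}$, $W_j\in\mathbb{R}^{m_j\times m_{j-1}}$ ($2\le j\le q-1$), $W_q\in\mathbb{R}^{1\times m_{q-1}}$, and computes $f^{\mathrm{NN}}(x;\Theta)=W_q\phi(W_{q-1}\phi(\cdots\phi(W_1x)\cdots))$ with $\phi$ applied elementwise. $\|\Theta\|_F^2=\sum_j\|W_j\|_F^2$. The maximum normalized margin for architecture $\mathcal{M}$ is $\gamma^{\star,\mathcal{M}}=\max_{\|\Theta\|_F\le1}\min_iy_if^{\mathrm{NN}}(x_i;\Theta)$, the maximum being over parameters with architecture $\mathcal{M}$. *)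

(* Defs.v *)
From HB Require Import structures.
From mathcomp Require Import all_boot all_order all_algebra.
From mathcomp Require Import all_classical all_reals all_analysis.
Set Implicit Arguments.
Unset Strict Implicit.
Unset Printing Implicit Defensive.
Import Order.TTheory GRing.Theory Num.Theory.
Import numFieldNormedType.Exports.
Local Open Scope classical_set_scope.
Local Open Scope ring_scope.

Definition pos_homogeneous (R : realType) (phi : R -> R) : Prop :=
  forall c t : R, 0 < c -> phi (c * t) = c * phi t.

(* The library norm on matrices is the max norm, hence these two. *)
Definition frob_sq (R : realType) (m n : nat) (A : 'M[R]_(m, n)) : R :=
  \sum_i \sum_j A i j ^+ 2.

Definition l2norm (R : realType) (d : nat) (v : 'cV[R]_d) : R :=
  Num.sqrt (\sum_i v i 0 ^+ 2).

(* For ms = [:: m_1; ...; m_(q-1)], an inhabitant of params R d ms is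
   (W_1, (W_2, ..., (W_(q-1), W_q))), with W_1 of size m_1 x d,
   W_j of size m_j x m_(j-1) and W_q of size 1 x m_(q-1). *)
Fixpoint params (R : realType) (d : nat) (ms : seq nat) : Type :=
  match ms with
  | [::] => 'M[R]_(1, d)
  | k :: ms' => ('M[R]_(k, d) * params R k ms')%type
  end.

Fixpoint params_sq (R : realType) (d : nat) (ms : seq nat) {struct ms} :
    params R d ms -> R :=
  match ms return params R d ms -> R with
  | [::] => fun W => frob_sq W
  | k :: ms' => fun Theta => frob_sq Theta.1 + params_sq Theta.2
  end.

Definition params_norm (R : realType) (d : nat) (ms : seq nat)
    (Theta : params R d ms) : R := Num.sqrt (params_sq Theta).

Fixpoint fNN (R : realType) (phi : R -> R) (d : nat) (ms : seq nat)
    {struct ms} : params R d ms -> 'cV[R]_d -> R :=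
  match ms return params R d ms -> 'cV[R]_d -> R with
  | [::] => fun W x => (W *m x) 0 0
  | k :: ms' => fun Theta x =>
      fNN phi Theta.2 (map_mx phi (Theta.1 *m x))
  end.

(* min_i y_i f(x_i; Theta) over a nonempty sample; the default value of the
   iterated minimum is the term of index 0, so it does not affect the result. *)
Definition margin (R : realType) (phi : R -> R) (d n : nat)
    (x : 'I_n.+1 -> 'cV[R]_d) (y : 'I_n.+1 -> R) (ms : seq nat)
    (Theta : params R d ms) : R :=
  \big[Num.min/y ord0 * fNN phi Theta (x ord0)]_(i < n.+1)
    (y i * fNN phi Theta (x i)).

Definition normalized_margins (R : realType) (phi : R -> R) (d n : nat)
    (x : 'I_n.+1 -> 'cV[R]_d) (y : 'I_n.+1 -> R) (ms : seq nat) : set R :=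
  [set margin phi x y Theta | Theta in
     [set Theta : params R d ms | params_norm Theta <= 1]].

Definition is_maximum (R : realType) (A : set R) (a : R) : Prop :=
  A a /\ ubound A a.

Definition max_margin (R : realType) (phi : R -> R) (d n : nat)
    (x : 'I_n.+1 -> 'cV[R]_d) (y : 'I_n.+1 -> R) (ms : seq nat) : R :=
  sup (normalized_margins phi x y ms).

Definition domain_radius (R : realType) (d : nat) (X : set 'cV[R]_d) : R :=
  sup [set l2norm v | v in X].

Definition log2 (R : realType) (t : R) : R := ln t / ln 2.

(* N is the sample size. *)
Definition gen_bound (R : realType) (q N : nat) (C delta gamma : R) : R :=
  C / (gamma * (q%:R `^ ((q%:R - 1) / 2)) * Num.sqrt N%:R)
  + Num.sqrt (ln (log2 (4 * C / gamma)) / N%:R)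
  + Num.sqrt (ln (1 / delta) / N%:R).

(* Main.v *)
(* A narrow network embeds in a wider one by zero-padding its weight matrices,
   which changes neither the function computed nor the Frobenius norm, so the
   attainable margins can only grow. The maxima exist because the unit ball of
   parameters is compact and the margin is continuous. Each term of the bound is
   nonincreasing in the margin. *)
Require Import Defs.
From HB Require Import structures.
From mathcomp Require Import all_boot all_order all_algebra.
From mathcomp Require Import all_classical all_reals all_analysis.
Set Implicit Arguments.
Unset Strict Implicit.
Unset Printing Implicit Defensive.
Import Order.TTheory GRing.Theory Num.Theory.
Import numFieldNormedType.Exports.
Local Open Scope classical_set_scope.
Local Open Scope ring_scope.

(** * Continuity of real-valued functions *)

Lemma lipschitz1_continuous (R : realType) (phi : R -> R) :
  1.-lipschitz phi -> continuous phi.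
Proof.
move=> phi_lip t; apply/cvgrPdist_lt => e e0.
near=> s.
apply: (@le_lt_trans _ _ `|t - s|).
  by have := phi_lip (t, s) (conj I I); rewrite /= mul1r.
by near: s; exact: cvgr_dist_lt.
Unshelve. all: end_near. Qed.

Lemma continuous_mulr (R : realType) (S : topologicalType) (f g : S -> R) :
  continuous f -> continuous g -> continuous (fun s => f s * g s).
Proof. by move=> cf cg s; apply: cvgM; [exact: cf|exact: cg]. Qed.

Lemma continuous_sum (R : realType) (S : topologicalType) (I : finType)
    (F : I -> S -> R) :
  (forall i, continuous (F i)) -> continuous (fun s => \sum_i F i s).
Proof. by move=> cF; apply: continuous_big => // z; exact: add_continuous. Qed.

(** The default value [e] varies with [s] too, since [margin] takes its own term of index 0 as
    default. *)
Lemma continuous_bigmin (R : realType) (S : topologicalType) (I : Type)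
    (r : seq I) (e : S -> R) (F : I -> S -> R) :
  continuous e -> (forall i, continuous (F i)) ->
  continuous (fun s => \big[Num.min/e s]_(i <- r) F i s).
Proof.
move=> ec Fc; elim: r => [|i r IH].
  by under eq_fun do rewrite big_nil.
under eq_fun do rewrite big_cons.
by move=> s; apply: continuous_min; [exact: Fc|exact: IH].
Qed.

(** * Squared norms and compact charts of the parameter space *)

Lemma frob_sq_ge0 (R : realType) (m n : nat) (A : 'M[R]_(m, n)) :
  0 <= frob_sq A.
Proof. by apply: sumr_ge0 => i _; apply: sumr_ge0 => j _; exact: sqr_ge0. Qed.

(** Serves to place the Frobenius unit ball inside a cube. *)
Lemma sqr_entry_le_frob_sq (R : realType) (m n : nat) (A : 'M[R]_(m, n)) i j :
  A i j ^+ 2 <= frob_sq A.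
Proof.
rewrite /frob_sq (bigD1 i) //= (bigD1 j) //= -addrA lerDl.
apply: addr_ge0; first by apply: sumr_ge0 => k _; exact: sqr_ge0.
by apply: sumr_ge0 => k _; apply: sumr_ge0 => l _; exact: sqr_ge0.
Qed.

Lemma params_sq_ge0 (R : realType) (d : nat) (ms : seq nat)
  (Theta : params R d ms) : 0 <= params_sq Theta.
Proof.
elim: ms d Theta => [|k ms IH] d Theta /=; first exact: frob_sq_ge0.
by apply: addr_ge0; [exact: frob_sq_ge0|exact: IH].
Qed.

(** Witness that the unit ball of parameters is nonempty, as the extreme value theorem requires. *)
Fixpoint params0 (R : realType) (d : nat) (ms : seq nat) : params R d ms :=
  match ms return params R d ms with
  | [::] => 0
  | k :: ms' => (0, params0 R k ms')
  end.

Lemma params_sq0 (R : realType) (d : nat) (ms : seq nat) :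
  params_sq (params0 R d ms) = 0.
Proof.
have frob0 m n : frob_sq (0 : 'M[R]_(m, n)) = 0.
  by apply: big1 => i _; apply: big1 => j _; rewrite mxE expr0n.
by elim: ms d => [|k ms IH] d /=; rewrite frob0 // IH addr0.
Qed.

Lemma params_norm_le1 (R : realType) (d : nat) (ms : seq nat)
  (Theta : params R d ms) : (params_norm Theta <= 1) = (params_sq Theta <= 1).
Proof. by rewrite /params_norm -[X in _ <= X]sqrtr1 ler_sqrt. Qed.

(* The matrices are charted by the product topology on [R ^ (m * n)], so that
   Tychonoff applies even when a dimension vanishes. *)
Lemma matrix_chart (R : realType) (m n : nat) :
  exists (T : topologicalType) (g : T -> 'M[R]_(m, n)),
    [/\ forall A, exists t, g t = A,
        forall i j, continuous (fun t => g t i j) &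
        compact [set t | frob_sq (g t) <= 1]].
Proof.
pose K := fun _ : ('I_m * 'I_n)%type => R : topologicalType.
pose g (f : prod_topology K) : 'M[R]_(m, n) := \matrix_(i, j) f (i, j).
have gc i j : continuous (fun t => g t i j).
  rewrite (_ : (fun t => _) = @proj _ K (i, j)); first exact: proj_continuous.
  by apply/funext => f; rewrite mxE.
exists (prod_topology K), g; split=> //.
  by move=> A; exists (fun p => A p.1 p.2); apply/matrixP => i j; rewrite mxE.
(* The unit ball is closed and lies in the cube of entries in [[-1, 1]]. *)
apply: (@subclosed_compact (prod_topology K) _
  [set f | forall p, `[-1, 1]%classic (f p)]).
- apply: (@preimage_closed _ _ (fun t => frob_sq (g t)) [set r | r <= 1]).
    move=> t _; move: t; apply: continuous_sum => i; apply: continuous_sum => j.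
    by apply: continuous_mulr; exact: gc.
  exact: closed_le.
- by apply: (@tychonoff _ K (fun=> `[-1, 1]%classic)) => p;
    exact: segment_compact.
- move=> f /= f1 [i j]; rewrite /= in_itv /= -ler_norml -(@expr_le1 _ 2)//.
  rewrite real_normK ?num_real//.
  by apply: le_trans f1; have := sqr_entry_le_frob_sq (g f) i j; rewrite mxE.
Qed.

(** Topological facts on the recursive type [params] are stated through a surjection [g] from a
    topological space. The input [h] varies with [s] because, in the induction, the later layers
    receive a hidden vector that depends on the first weight matrix. *)
Lemma params_chart (R : realType) (phi : R -> R) (d : nat) (ms : seq nat) :
  continuous phi ->
  exists (T : topologicalType) (g : T -> params R d ms),
    [/\ forall Theta, exists t, g t = Theta,
        continuous (fun t => params_sq (g t)),
        compact [set t | params_sq (g t) <= 1] &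
        forall (S : topologicalType) (u : S -> T) (h : S -> 'cV[R]_d),
          continuous u -> (forall i, continuous (fun s => h s i 0)) ->
          continuous (fun s => fNN phi (g (u s)) (h s))].
Proof.
move=> phic.
have mulmxc (S : topologicalType) (m n : nat) (W : S -> 'M[R]_(m, n))
    (h : S -> 'cV[R]_n) i :
    (forall i j, continuous (fun s => W s i j)) ->
    (forall i, continuous (fun s => h s i 0)) ->
    continuous (fun s => (W s *m h s) i 0).
  move=> Wc hc.
  under eq_fun do rewrite mxE.
  by apply: continuous_sum => j; exact: continuous_mulr.
have frobc (S : topologicalType) (m n : nat) (W : S -> 'M[R]_(m, n)) :
    (forall i j, continuous (fun s => W s i j)) ->
    continuous (fun s => frob_sq (W s)).
  move=> Wc; apply: continuous_sum => i; apply: continuous_sum => j.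
  exact: continuous_mulr.
have compc (S T : topologicalType) (u : S -> T) (f : T -> R) :
    continuous u -> continuous f -> continuous (fun s => f (u s)).
  by move=> uc fc s; apply: continuous_comp; [exact: uc|exact: fc].
elim: ms d => [|k ms IH] d.
  have [T [g [gsurj gc gK]]] := matrix_chart R 1 d.
  exists T, g; split=> //; first exact: frobc.
  move=> S u h uc hc /=; apply: mulmxc => // i j.
  exact: (compc _ _ u (fun t => g t i j)).
have [T1 [g1 [g1surj g1c g1K]]] := matrix_chart R k d.
have [T2 [g2 [g2surj g2c g2K g2f]]] := IH k.
have fstc : continuous (@fst T1 T2) by move=> ?; exact: cvg_fst.
have sndc : continuous (@snd T1 T2) by move=> ?; exact: cvg_snd.
pose g (t : T1 * T2) : params R d (k :: ms) := (g1 t.1, g2 t.2).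
have gsqc : continuous (fun t => params_sq (g t)).
  move=> t; apply: (@continuousD _ _ _ (fun t => frob_sq (g1 t.1))
    (fun t => params_sq (g2 t.2))).
    by apply: (compc _ _ fst (fun t => frob_sq (g1 t))) => //; exact: frobc.
  exact: (compc _ _ snd (fun t => params_sq (g2 t))).
exists (T1 * T2)%type, g; split=> //.
- move=> [A Theta]; have [t1 <-] := g1surj A; have [t2 <-] := g2surj Theta.
  by exists (t1, t2).
(* Both summands of the squared norm are nonnegative, so the unit ball is a closed subset of the
   product of the two unit balls. *)
- apply: (subclosed_compact _ (compact_setX g1K g2K)).
    apply: (@preimage_closed _ _ (fun t => params_sq (g t)) [set r | r <= 1]).
      by move=> t _; exact: gsqc.
    exact: closed_le.
  move=> t /= t1; split=> /=; apply: le_trans t1.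
    by rewrite lerDl params_sq_ge0.
  by rewrite lerDr frob_sq_ge0.
- move=> S u h uc hc /=.
  apply: (g2f _ (snd \o u)).
    by move=> s; apply: continuous_comp; [exact: uc|exact: sndc].
  move=> i; under eq_fun do rewrite mxE.
  apply: (compc _ _ (fun s => (g1 (u s).1 *m h s) i 0)) => //.
  apply: mulmxc => // i' j'.
  apply: (compc _ _ u (fun t => g1 t.1 i' j')) => //.
  exact: (compc _ _ fst (fun t => g1 t i' j')).
Qed.

(** * Existence of the maximum margin *)

Lemma max_margin_is_maximum (R : realType) (phi : R -> R) (d n : nat)
    (x : 'I_n.+1 -> 'cV[R]_d) (y : 'I_n.+1 -> R) (ms : seq nat) :
  continuous phi ->
  is_maximum (normalized_margins phi x y ms) (max_margin phi x y ms).
Proof.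
move=> phic; have [T [g [gsurj _ gK gf]]] := params_chart d ms phic.
have marg1c i : continuous (fun t => y i * fNN phi (g t) (x i)).
  apply: continuous_mulr => [t|]; first exact: cvg_cst.
  by apply: (gf T id (fun=> x i)) => [t|j t]; [exact: cvg_id|exact: cvg_cst].
have marginc : continuous (fun t => margin phi x y (g t)).
  by apply: continuous_bigmin => [|i]; exact: marg1c.
have [|t /set_mem/= t1 tmax] :=
  compact_EVT_max _ gK (continuous_subspaceT marginc).
  by have [t t0] := gsurj (params0 R d ms); exists t; rewrite /= t0 params_sq0.
have max_ub : ubound (normalized_margins phi x y ms) (margin phi x y (g t)).
  move=> _ [th /= th1 <-]; have [s sE] := gsurj th.
  by rewrite -sE; apply/tmax/mem_set; rewrite /= sE -params_norm_le1.
have max_in : normalized_margins phi x y ms (margin phi x y (g t)).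
  by exists (g t); rewrite //= params_norm_le1.
(* An upper bound that belongs to the set is its supremum. *)
suff -> : max_margin phi x y ms = margin phi x y (g t) by split.
apply/eqP; rewrite eq_le; apply/andP; split.
  by apply: ge_sup => //; eexists; exact: max_in.
by apply: ub_le_sup => //; eexists; exact: max_ub.
Qed.

(** * Zero-padding of networks *)

Lemma frob_sq_pad (R : realType) (m n a b : nat) (A : 'M[R]_(m, n)) :
  frob_sq (block_mx A 0 0 0 : 'M[R]_(m + a, n + b)) = frob_sq A.
Proof.
rewrite /frob_sq big_split_ord/= [X in _ + X]big1 ?addr0 => [|i _]; last first.
  by apply: big1 => j _; rewrite col_mxEd row_mx0 mxE expr0n.
apply: eq_bigr => i _.
rewrite big_split_ord/= [X in _ + X]big1 ?addr0 => [|j _]; last first.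
  by rewrite block_mxEur mxE expr0n.
by apply: eq_bigr => j _; rewrite block_mxEul.
Qed.

(* The columns of the first layer of [th'] beyond [d] vanish, so [z] need only
   agree with [x] on the first [d] entries. *)
Lemma params_pad (R : realType) (phi : R -> R) (ms ms' : seq nat) (d d' : nat)
    (th : params R d ms) :
  (d <= d')%N ->
  size ms = size ms' -> (forall i, (nth 0 ms i <= nth 0 ms' i)%N) ->
  exists th' : params R d' ms',
    params_sq th' = params_sq th /\
    forall (x : 'cV[R]_d) (z : 'cV[R]_d'),
      (forall (i : 'I_d) (j : 'I_d'), i = j :> nat -> x i 0 = z j 0) ->
      fNN phi th' z = fNN phi th x.
Proof.
have agree_col_mx m e (x : 'cV[R]_m) (z : 'cV[R]_(m + e)) :
    (forall (i : 'I_m) (j : 'I_(m + e)), i = j :> nat -> x i 0 = z j 0) ->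
    z = col_mx x (dsubmx z).
  move=> xz; rewrite -[LHS]vsubmxK; congr col_mx.
  by apply/colP => i; rewrite mxE -(xz i).
elim: ms ms' d d' th => [|k ms IH] [|k' ms'] //= d d' th /subnKC <-.
  (* Last layer: the zeros appended to the row cancel the entries of [z] beyond [d]. *)
  move: (d' - d)%N => e _ _; exists (row_mx th 0); split.
    rewrite /frob_sq !big_ord1 big_split_ord/= [X in _ + X]big1 ?addr0.
      by apply: eq_bigr => j _; rewrite row_mxEl.
    by move=> j _; rewrite row_mxEr mxE expr0n.
  by move=> x z /agree_col_mx ->; rewrite mul_row_col mul0mx addr0.
move: (d' - d)%N => e; case: th => W th [sz] le_ms.
have [th' [th'sq th'f]] :=
  IH ms' k k' th (le_ms 0) sz (fun i => le_ms i.+1).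
have /subnKC k'E := le_ms 0; rewrite /= in k'E.
(* Writing [k'] as [k + a] gives the padded block matrix its required type. *)
move: th' th'sq th'f; rewrite -{}k'E; move: (k' - k)%N => a.
move=> th' th'sq th'f.
exists (block_mx W 0 0 0, th'); split=> [|x z /agree_col_mx ->] /=.
  by rewrite frob_sq_pad th'sq.
(* The extra hidden units output [phi 0], whatever its value: the induction hypothesis only asks for
   agreement on the first [k] entries. *)
rewrite mul_block_col !mul0mx !addr0 map_col_mx; apply: th'f => i j ij.
by rewrite (_ : j = lshift a i) ?col_mxEu//; exact/val_inj.
Qed.

(** The input dimension stays [d], so the padded network takes the same values on the data and has
    the same norm. *)
Lemma normalized_margins_sub (R : realType) (phi : R -> R) (d n : nat)
    (x : 'I_n.+1 -> 'cV[R]_d) (y : 'I_n.+1 -> R) (ms ms' : seq nat) :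
  size ms = size ms' -> (forall i, (nth 0 ms i <= nth 0 ms' i)%N) ->
  normalized_margins phi x y ms `<=` normalized_margins phi x y ms'.
Proof.
move=> sz le_ms _ [th /= th1 <-].
have [th' [th'sq th'f]] := params_pad phi th (leqnn d) sz le_ms.
have fE i : fNN phi th' (x i) = fNN phi th (x i).
  by apply: th'f => j l /val_inj ->.
exists th'; first by rewrite /= params_norm_le1 th'sq -params_norm_le1.
(* The first [fE] acts on the default value of the minimum, the second on its terms. *)
by rewrite /margin fE; apply: eq_bigr => i _; rewrite fE.
Qed.

(** * Monotonicity of the generalization bound *)

Lemma ln_le_ln_pos (R : realType) (a b : R) :
  0 < a -> a <= b -> ln a <= ln b.
Proof. by move=> a0 ab; rewrite ler_ln// posrE// (lt_le_trans a0). Qed.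

Lemma gen_bound_nonincreasing (R : realType) (q N : nat) (C delta g g' : R) :
  0 <= C -> 0 < g -> g <= g' ->
  gen_bound q N C delta g' <= gen_bound q N C delta g.
Proof.
move=> C0 g0 gg'; have g'0 := lt_le_trans g0 gg'.
have Cgg' c : 0 <= c -> c / g' <= c / g.
  by move=> c0; rewrite ler_wpM2l// lef_pV2.
rewrite /gen_bound; apply: lerD => //; apply: lerD.
  (* Splitting the inverse isolates [C / g], multiplied by the same nonnegative factors on both
     sides. *)
  rewrite !invfM !mulrA.
  by do 2![apply: ler_wpM2r; first by rewrite invr_ge0 ?powR_ge0 ?sqrtr_ge0];
    exact: Cgg'.
(* [ln] is 0 on nonpositive arguments, which [log2 (4 * C / g')] may be. *)
have log_le : log2 (4 * C / g') <= log2 (4 * C / g).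
  rewrite /log2 ler_wpM2r ?invr_ge0 ?ln_ge0 ?ler1n//.
  (* For [C = 0] both logarithms are [ln 0]; otherwise their arguments are positive. *)
  have [C00|Cneq0] := eqVneq C 0; first by rewrite C00 mulr0 !mul0r.
  apply: ln_le_ln_pos; last by apply: Cgg'; rewrite mulr_ge0.
  by rewrite divr_gt0// mulr_gt0// lt_neqAle eq_sym Cneq0.
(* If the inner logarithm at [g'] is nonpositive, the left square root is 0. *)
have [log0|log0] := leP (log2 (4 * C / g')) 0.
  by rewrite ln0// mul0r sqrtr0 sqrtr_ge0.
by rewrite ler_wsqrtr// ler_wpM2r ?invr_ge0 ?ler0n// ln_le_ln_pos.
Qed.

(** * Comparison of the two architectures *)

Theorem theorem4p3 (R : realType) (q : nat) (hq : (2 <= q)%N)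
    (phi : R -> R) (phi_lip : 1%R.-lipschitz phi)
    (phi_hom : pos_homogeneous phi)
    (d n : nat) (x : 'I_n.+1 -> 'cV[R]_d) (y : 'I_n.+1 -> R)
    (hy : forall i, y i = -1 \/ y i = 1)
    (M M' : (q.-1).-tuple nat)
    (hM : forall i : 'I_q.-1, (tnth M i <= tnth M' i)%N) :
  [/\ is_maximum (normalized_margins phi x y M) (max_margin phi x y M),
      is_maximum (normalized_margins phi x y M') (max_margin phi x y M'),
      max_margin phi x y M <= max_margin phi x y M' &
      0 < max_margin phi x y M ->
      forall (X : set 'cV[R]_d) (delta : R),
        (forall i, X (x i)) ->
        has_ubound [set l2norm v | v in X] ->
        0 < delta < 1 ->
        gen_bound q n.+1 (domain_radius X) delta (max_margin phi x y M')
        <= gen_bound q n.+1 (domain_radius X) delta (max_margin phi x y M)].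
Proof.
have phic := lipschitz1_continuous phi_lip.
have maxM := max_margin_is_maximum x y M phic.
have maxM' := max_margin_is_maximum x y M' phic.
have le_nth i : (nth 0 M i <= nth 0 M' i)%N.
  (* Past the last hidden layer, [nth] returns the default 0. *)
  have [iq|qi] := ltnP i q.-1; last by rewrite nth_default// size_tuple.
  by have := hM (Ordinal iq); rewrite !(tnth_nth 0).
have le_margin : max_margin phi x y M <= max_margin phi x y M'.
  (* The maximum for [M] is attained, hence is also a margin for [M']. *)
  apply: maxM'.2; apply: (normalized_margins_sub _ le_nth); last exact: maxM.1.
  by rewrite !size_tuple.
split=> // margin_gt0 X delta xX Xbd _.
apply: gen_bound_nonincreasing => //.
(* The radius is nonnegative because it bounds the norm of a sample point. *)
apply: (@le_trans _ _ (l2norm (x ord0))); first exact: sqrtr_ge0.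
by apply: ub_le_sup => //; exists (x ord0).
Qed.
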